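(* Let $\Phi$ be a homogeneous Poisson point process with intensity $\lambda>0$ on $\mathbb{R}$ (dimension $d=1$), and let $R_o$ be the distance from the nucleus to a uniformly random point in the typical cell $V_o$. Then the cumulative distribution function of $R_o$ is $$F_{R_o}(r)=1-\exp(-2\lambda r)+2\lambda r\exp(-2\lambda r)-4\lambda^2r^2\,\mathtt{E}_1(2\lambda r),\qquad r>0,$$ where $\mathtt{E}_1(z)=\int_z^\infty \frac{1}{t}\exp(-t)\,{\rm d}t$ is the exponential integral function.
   Context: The typical cell of the Poisson-Voronoi tessellation is the cell with nucleus at the origin $o$ in the Voronoi tessellation generated by $\Phi\cup\{o\}$, i.e. (here in dimension one) $V_o=\{y\in\mathbb{R} : |y|\le |x-y|\ \ \forall x\in\Phi\}$. Conditionally on $\Phi$, let $Y$ be uniformly distributed on $V_o$; then $R_o=|Y|$. *)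

(* Defs.v *)
From HB Require Import structures.
From mathcomp Require Import all_boot all_order all_algebra.
From mathcomp Require Import all_classical all_reals all_analysis.
From mathcomp Require Import measurable_realfun.

Set Implicit Arguments.
Unset Strict Implicit.
Unset Printing Implicit Defensive.

Import Order.TTheory GRing.Theory Num.Theory.
Import numFieldNormedType.Exports.

Local Open Scope classical_set_scope.
Local Open Scope ring_scope.

Definition mutually_independent (d d' : measure_display) (T : measurableType d)
    (T' : measurableType d') (R : realType) (P : probability T R) (n : nat)
    (X : 'I_n -> T -> T') : Prop :=
  (* Taking some of the E i equal to setT gives the product rule for every
     subfamily. *)
  forall E : 'I_n -> set T', (forall i, measurable (E i)) ->
    P (\bigcap_(i in [set: 'I_n]) (X i @^-1` E i)) =
    (\prod_(i < n) P (X i @^-1` E i))%E.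

(* A simple point process on the line is encoded by its random set of points. *)
Definition point_count (T : Type) (R : realType) (Phi : T -> set R)
    (B : set R) (w : T) : \bar R :=
  counting (Phi w `&` B).

Definition simple_point_process (d : measure_display) (T : measurableType d)
    (R : realType) (Phi : T -> set R) : Prop :=
  (forall w (a b : R), finite_set (Phi w `&` `[a, b])) /\
  (forall B : set R, measurable B ->
     measurable_fun [set: T] (point_count Phi B)).

(* The Poisson probabilities are written out because [poisson_pmf] is 1 for
   every k at rate 0, the rate of a null set. *)
Definition homogeneous_poisson_process (d : measure_display)
    (T : measurableType d) (R : realType) (P : probability T R) (lambda : R)
    (Phi : T -> set R) : Prop :=
  [/\ simple_point_process Phi,
      forall B : set R, measurable B -> (lebesgue_measure B < +oo)%E ->
        forall k : nat,
          let m := lambda * fine (lebesgue_measure B) in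
          P [set w | point_count Phi B w = k%:R%:E] =
          (m ^+ k / k`!%:R * expR (- m))%:E
    & forall (n : nat) (B : 'I_n -> set R), (forall i, measurable (B i)) ->
        trivIset [set: 'I_n] B ->
        mutually_independent P (fun i => point_count Phi (B i))].

Definition process_sigma_algebra (T : Type) (R : realType) (Phi : T -> set R) :
    set (set T) :=
  <<s [set A | exists B : set R, measurable B /\
         exists S : set (\bar R), measurable S /\
         A = point_count Phi B @^-1` S] >>.

Definition typical_cell (R : realType) (phi : set R) : set R :=
  [set y | forall x, phi x -> `|y| <= `|x - y|].

(* Meaningful when 0 < lebesgue_measure V < +oo; the value is 0 otherwise. *)
Definition uniform_on (R : realType) (V B : set R) : R :=
  fine (lebesgue_measure (V `&` B)) / fine (lebesgue_measure V).

(* [uniform_on (typical_cell (Phi w))] is a version of the conditional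
   distribution of Y given Phi. *)
Definition uniform_in_typical_cell (d : measure_display) (T : measurableType d)
    (R : realType) (P : probability T R) (Phi : T -> set R) (Y : T -> R) :
    Prop :=
  forall (A : set T) (B : set R), process_sigma_algebra Phi A -> measurable B ->
    P (A `&` Y @^-1` B) =
    (\int[P]_(w in A) (uniform_on (typical_cell (Phi w)) B)%:E)%E.

Definition distance_to_nucleus (d : measure_display) (T : measurableType d)
    (R : realType) (P : probability T R) (Y : {RV P >-> R}) : {RV P >-> R} :=
  ((@Num.norm R R) \o Y)%FUN.

Definition E1 (R : realType) (z : R) : R :=
  \int[lebesgue_measure]_(t in `[z, +oo[) (t^-1 * expR (- t)).

(* Main.v *)
Require Import Defs.
From HB Require Import structures.
From mathcomp Require Import all_boot all_order all_algebra.
From mathcomp Require Import all_classical all_reals all_analysis.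
From mathcomp Require Import measurable_realfun.
From mathcomp Require Import ring lra.

Import Order.TTheory GRing.Theory Num.Theory.
Import numFieldNormedType.Exports.

Local Open Scope classical_set_scope.
Local Open Scope ring_scope.

(** Let [a] and [b] be half the distances from the origin to the nearest point
of the process on its right and on its left.  Almost surely both sides carry
points, the typical cell is then the segment [[-b, a]], and the conditional
probability that [|Y| <= r] is [(min(a, r) + min(b, r)) / (a + b)]
([typical_cell_itv], [uniform_on_itv]).

With [m = 2 * lambda], the event [s <= a, t <= b] says that the process has no
point in a set of length [2 * (s + t)], so it has probability
[exp(-m (s + t))] ([reach_joint_tail]): the void probabilities alone make [a]
and [b] independent exponential variables of rate [m].

The expectation of the ratio splits as products once its denominator is
linearised by [1 / D = \int_0^oo exp(- u D) du] and its numerator by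
[min(a, r) = \int_0^r 1{s <= a} ds]: by Tonelli, all that is needed is
[E[1{s <= a} exp(-u a) exp(-u b)] = (m / (m + u))^2 exp(-(m + u) s)]
([joint_laplace]).  Integrating in [s] over [[0, r]], and then in [u] after the
change of variable [t = (m + u) r], one gets
[E[min(a, r) / (a + b)] =
  (m r)^2 \int_(m r)^oo t^-3 (1 - exp(-t)) dt] ([expectation_min_ratio]).
Two integrations by parts, merged into one antiderivative, reduce this integral
to the exponential integral ([integral_tail_E1]).  The term in [min(b, r)]
contributes the same amount by symmetry. *)

(** * Integrals of exponentials and the exponential integral *)

Section Calculus.
Context {R : realType}.
Local Notation mu := (@lebesgue_measure R).
Implicit Types (F f : R -> R) (a b c s t z : R).

Lemma integral_itv_antiderivative F f a b : a <= b ->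
  (forall x, is_derive x (1 : R) F (f x)) -> continuous f ->
  (\int[mu]_(x in `[a, b]) (f x)%:E = (F b - F a)%:E)%E.
Proof.
rewrite le_eqVlt => /predU1P[<- _ _|ab dF cf].
  by rewrite set_itv1 integral_set1 subrr.
have F_cont : continuous F.
  by move=> x; apply/differentiable_continuous/derivable1_diffP; case: (dF x).
rewrite EFinB; apply: continuous_FTC2 => //.
- exact: continuous_subspaceT.
- split => [x _||]; first by case: (dF x).
  + exact/cvg_at_right_filter/F_cont.
  + exact/cvg_at_left_filter/F_cont.
- by move=> x _; rewrite derive1E derive_val.
Qed.

Lemma ge0_integral_ray_antiderivative F f a l :
  (forall x, a <= x -> 0 <= f x) ->
  (forall x, a <= x -> is_derive x (1 : R) F (f x)) ->
  (forall x, a <= x -> {for x, continuous f}) ->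
  F x @[x --> +oo] --> l ->
  (\int[mu]_(x in `[a, +oo[) (f x)%:E = (l - F a)%:E)%E.
Proof.
move=> f_ge0 dF cf Fl.
have F_cont x : a <= x -> {for x, continuous F}.
  by move=> /dF[/derivable1_diffP/differentiable_continuous].
rewrite EFinB; apply: ge0_continuous_FTC2y => //.
- apply: continuous_in_subspaceT => x.
  by rewrite inE/= in_itv/= andbT => /cf.
- by move=> x /ltW/dF[].
- exact/cvg_at_right_filter/F_cont.
- move=> x; rewrite in_itv/= andbT => /ltW/dF xdF.
  by rewrite derive1E derive_val.
Qed.

Lemma is_derive_expR_scaled c x :
  is_derive x (1 : R) (fun y => - expR (- (c * y))) (c * expR (- (c * x))).
Proof.
apply: is_derive_eq.
by rewrite /GRing.scale/=; ring.
Qed.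

Lemma continuous_expR_scaled c : continuous (fun y : R => c * expR (- (c * y))).
Proof.
move=> x; apply: cvgM; first exact: cvg_cst.
apply: (@continuous_comp _ _ _ (fun y => - (c * y)) expR).
  2: exact: continuous_expR.
by apply: cvgN; apply: cvgM; [exact: cvg_cst|exact: cvg_id].
Qed.

Let continuous_expN : continuous (fun x : R => expR (- x)).
Proof.
move=> x.
by apply: continuous_comp; [exact: opp_continuous|exact: continuous_expR].
Qed.

Lemma integral_expR_itv c a b : a <= b ->
  (\int[mu]_(x in `[a, b]) (c * expR (- (c * x)))%:E =
   (expR (- (c * a)) - expR (- (c * b)))%:E)%E.
Proof.
move=> ab.
rewrite (integral_itv_antiderivative _ _ _ _ ab (is_derive_expR_scaled c)
  (continuous_expR_scaled c)).
by rewrite opprK addrC.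
Qed.

Lemma cvgy_expRN c : 0 < c -> expR (- (c * x)) @[x --> +oo] --> 0.
Proof.
move=> c0; apply: (cvg_comp _ _ _ (@cvgr_expR R)).
exact: gt0_cvgMry.
Qed.

Lemma integral_expR_ray c a : 0 < c ->
  (\int[mu]_(x in `[a, +oo[) (c * expR (- (c * x)))%:E =
   (expR (- (c * a)))%:E)%E.
Proof.
move=> c0.
have -> : expR (- (c * a)) = 0 - - expR (- (c * a)) by rewrite sub0r opprK.
apply: (ge0_integral_ray_antiderivative (fun y => - expR (- (c * y)))).
- by move=> x _; rewrite mulr_ge0 ?expR_ge0 ?ltW.
- by move=> x _; exact: is_derive_expR_scaled.
- by move=> x _; exact: continuous_expR_scaled.
- by rewrite -oppr0; apply: cvgN; exact: cvgy_expRN.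
Qed.

Let weight z := 2 * z^-1 ^+ 3 * (1 - expR (- z)).

Let primitive z := - (z^-1 ^+ 2 * (1 - expR (- z) + z * expR (- z))).

(** This combines the integrations by parts of [t^-3 (1 - exp(-t))] and of
[t^-2 exp(-t)], whose remaining integral is that of [E1]. *)
Let is_derive_primitive z : 0 < z ->
  is_derive z (1 : R) primitive (weight z + z^-1 * expR (- z)).
Proof.
move=> z0; have zn0 : z != 0 by rewrite gt_eqF.
have dV : is_derive z (1 : R) (fun x : R => x^-1) (- z ^- 2).
  have := is_deriveV zn0 (is_derive_id z (1 : R)).
  by rewrite /GRing.scale/= mulr1.
rewrite /primitive/weight.
apply: is_derive_eq.
rewrite /GRing.scale/=; field.
exact: zn0.
Qed.

Let primitive_cvg0 : primitive z @[z --> +oo] --> 0.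
Proof.
have -> : primitive =
    fun z => - (z^-1 ^+ 2 * (1 - expR (- z)) + z^-1 * expR (- z)).
  apply/funext => z; rewrite /primitive; have [->|z0] := eqVneq z 0.
    by rewrite invr0 !expr2 !mul0r addr0.
  by field.
have Vcvg : x^-1 @[x --> +oo] --> (0 : R).
  apply/(gtr0_cvgV0 (f := id)); last exact: cvg_id.
  exact: nbhs_pinfty_gt.
have Ecvg : expR (- x) @[x --> +oo] --> (0 : R) by exact: cvgr_expR.
have -> : (0 : R) = - (0 ^+ 2 * (1 - 0) + 0 * 0).
  by rewrite expr2 !mul0r addr0 oppr0.
apply: cvgN; apply: cvgD; last exact: cvgM.
apply: cvgM; last by apply: cvgB => //; exact: cvg_cst.
by rewrite expr2; under eq_fun do rewrite expr2; exact: cvgM.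
Unshelve. all: by end_near. Qed.

Let measurable_E1_integrand z : 0 < z ->
  measurable_fun `[z, +oo[ (fun t : R => (t^-1 * expR (- t))%:E).
Proof.
move=> z0; apply/measurable_EFinP.
apply: subspace_continuous_measurable_fun => //.
apply: continuous_in_subspaceT => x.
rewrite inE/= in_itv/= andbT => zx.
apply: cvgM; last exact: continuous_expN.
by apply: inv_continuous; rewrite gt_eqF// (lt_le_trans z0).
Qed.

(** [E1] is a real-valued integral, which would be [0] if the integral diverged;
the bound [exp(-z) / z] excludes this. *)
Let E1_integral z : 0 < z ->
  (\int[mu]_(t in `[z, +oo[) (t^-1 * expR (- t))%:E = (E1 z)%:E)%E.
Proof.
move=> z0.
have pos t : z <= t -> 0 < t by exact: lt_le_trans.
rewrite /E1 /Rintegral fineK// ge0_fin_numE; last first.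
  apply: integral_ge0 => t /=; rewrite in_itv/= andbT => /pos t0.
  by rewrite lee_fin mulr_ge0 ?expR_ge0// invr_ge0 ltW.
apply: (@le_lt_trans _ _ ((z^-1 * expR (- (1 * z)))%:E)%E); last exact: ltry.
rewrite EFinM -(integral_expR_ray _ _ ltr01) -ge0_integralZl//; last 2 first.
- apply/measurable_EFinP; apply: measurable_funTS.
  apply: continuous_measurable_fun.
  exact: continuous_expR_scaled.
- by rewrite lee_fin invr_ge0 ltW.
apply: ge0_le_integral => //.
- move=> t /=; rewrite in_itv/= andbT => /pos t0.
  by rewrite lee_fin mulr_ge0 ?expR_ge0// invr_ge0 ltW.
- exact: measurable_E1_integrand.
- apply: emeasurable_funM => //.
  apply/measurable_EFinP; apply: measurable_funTS.
  apply: continuous_measurable_fun.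
  exact: continuous_expR_scaled.
- move=> t /=; rewrite in_itv/= andbT => zt.
  by rewrite -EFinM lee_fin !mul1r ler_wpM2r ?expR_ge0// lef_pV2 ?posrE// pos.
Qed.

Lemma tail_integrand_ge0 t : 0 < t -> 0 <= 2 * t^-1 ^+ 3 * (1 - expR (- t)).
Proof.
move=> /ltW t0; rewrite !mulr_ge0 ?exprn_ge0 ?invr_ge0//.
by rewrite subr_ge0 -expR0 ler_expR oppr_le0.
Qed.

Let continuous_weight t : 0 < t -> {for t, continuous weight}.
Proof.
move=> t0; apply: cvgM; last first.
  by apply: cvgB; [exact: cvg_cst|exact: continuous_expN].
apply: cvgM; first exact: cvg_cst.
apply: (@continuous_comp _ _ _ (fun x : R => x^-1) (fun x => x ^+ 3)).
  by apply: inv_continuous; rewrite gt_eqF.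
exact: exprn_continuous.
Qed.

Lemma measurable_tail_integrand z : 0 < z ->
  measurable_fun `[z, +oo[
    (fun t : R => (2 * t^-1 ^+ 3 * (1 - expR (- t)))%:E).
Proof.
move=> z0; apply/measurable_EFinP.
apply: subspace_continuous_measurable_fun => //.
apply: continuous_in_subspaceT => x.
by rewrite inE/= in_itv/= andbT => /(lt_le_trans z0)/continuous_weight.
Qed.

(** All integrands are nonnegative, so that the integral of the weight is
recovered by subtracting the finite [E1 z] from the total increment of the
antiderivative. *)
Lemma integral_tail_E1 z : 0 < z ->
  (\int[mu]_(t in `[z, +oo[) (2 * t^-1 ^+ 3 * (1 - expR (- t)))%:E =
   (z^-1 ^+ 2 * (1 - expR (- z) + z * expR (- z)) - E1 z)%:E)%E.
Proof.
move=> z0.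
have pos t : z <= t -> 0 < t by exact: lt_le_trans.
have E_ge0 t : z <= t -> 0 <= t^-1 * expR (- t).
  by move=> /pos t0; rewrite mulr_ge0 ?expR_ge0// invr_ge0 ltW.
have total : (\int[mu]_(t in `[z, +oo[) (weight t + t^-1 * expR (- t))%:E =
    (0 - primitive z)%:E)%E.
  apply: ge0_integral_ray_antiderivative => //.
  - by move=> t zt; rewrite addr_ge0 ?E_ge0// tail_integrand_ge0// pos.
  - by move=> t /pos; exact: is_derive_primitive.
  - move=> t /pos t0; apply: cvgD; first exact: continuous_weight.
    apply: cvgM; last exact: continuous_expN.
    by apply: inv_continuous; rewrite gt_eqF.
move: total; under eq_integral do rewrite EFinD.
rewrite ge0_integralD//; last 4 first.
- move=> t /=; rewrite in_itv/= andbT => /pos/tail_integrand_ge0.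
  by rewrite lee_fin.
- exact: measurable_tail_integrand.
- by move=> t /=; rewrite in_itv/= andbT => /E_ge0; rewrite lee_fin.
- exact: measurable_E1_integrand.
rewrite E1_integral// => total.
rewrite -[LHS](@addeK _ (E1 z)%:E)// total -EFinB; congr EFin.
by rewrite sub0r opprK.
Qed.

End Calculus.

(** * Expectations of functions of two exponential variables *)

Section Probability.
Context {R : realType} {d : measure_display} {T : measurableType d}.
Variable P : probability T R.
Local Notation mu := (@lebesgue_measure R).
Implicit Types (a b G : T -> R) (r s t u C : R).

Lemma eq_measure_off_null (A B N : set T) :
  measurable A -> measurable B -> measurable N -> P N = 0%E ->
  A `\` N = B `\` N -> P A = P B.
Proof.
move=> mA mB mN N0 AB.
have off D : measurable D -> P D = P (D `\` N).
  move=> mD; rewrite (measureDI P mD mN).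
  rewrite [X in (_ + X)%E](_ : _ = 0%E) ?adde0//.
  by apply: (subset_measure0 _ _ _ N0) => //; exact: measurableI.
by rewrite off// AB -off.
Qed.

Lemma measurable_bool_natr {d'} {T' : measurableType d'} (c : T' -> bool) :
  measurable_fun setT c -> measurable_fun setT (fun x => (c x)%:R : R).
Proof.
move=> mc; rewrite (_ : (fun _ => _) = fun x => if c x then 1 else 0).
  by apply: measurable_fun_ifT => //; exact: measurable_cst.
by apply/funext => x; case: (c x).
Qed.

Lemma measurable_tail_indicator a : measurable_fun setT a ->
  measurable_fun setT (fun p : T * R => (p.2 <= a p.1)%R%:R : R).
Proof.
move=> ma; apply: measurable_bool_natr; apply: measurable_fun_ler.
  exact: measurable_snd.
exact: (measurableT_comp ma measurable_fst).
Qed.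

Lemma measurable_expRN {d'} {T' : measurableType d'} (c : T' -> R) :
  measurable_fun setT c -> measurable_fun setT (fun w => expR (- c w)).
Proof.
move=> mc; apply: measurableT_comp; first exact: measurable_expR.
exact: measurable_funN.
Qed.

(** On nonnegative numbers the inverse is the power of exponent [-1], with the
same value [0] at [0]; its measurability is thus that of real powers, although
it is not continuous at [0]. *)
Lemma measurable_min_ratio a b r :
  (forall w, 0 <= a w) -> (forall w, 0 <= b w) ->
  measurable_fun setT a -> measurable_fun setT b ->
  measurable_fun setT (fun w => Num.min (a w) r / (a w + b w)).
Proof.
move=> a0 b0 ma mb; apply: measurable_funM; first exact: measurable_minr.
under eq_fun do rewrite -powR_inv1 ?addr_ge0//.
exact: (measurableT_comp (measurable_powR (-1)) (measurable_funD ma mb)).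
Qed.

Section Tonelli.
Variables (D : set R) (f : T -> R -> R).
Hypothesis mD : measurable D.
Hypothesis mf : measurable_fun setT (fun p : T * R => f p.1 p.2).
Hypothesis f_ge0 : forall w x, D x -> 0 <= f w x.

Let g (p : T * R) : \bar R := (\1_D p.2 * f p.1 p.2)%:E.

Let mg : measurable_fun setT g.
Proof.
apply/measurable_EFinP; apply: measurable_funM => //.
have mI : measurable_fun setT (\1_D : R -> R) by exact: measurable_indic.
exact: (measurableT_comp mI measurable_snd).
Qed.

Let g_ge0 p : (0 <= g p)%E.
Proof.
rewrite /g lee_fin indicE; case: (boolP (p.2 \in D)) => [|_].
  by rewrite inE mul1r => /f_ge0.
by rewrite mul0r.
Qed.

Let integral_g w :
  (\int[mu]_(x in D) (f w x)%:E = \int[mu]_x g (w, x))%E.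
Proof.
rewrite integral_mkcond; apply: eq_integral => x _.
by rewrite patchE /g indicE/=; case: ifPn => _; rewrite ?mul1r ?mul0r.
Qed.

Lemma measurable_integral_on :
  measurable_fun setT (fun w => \int[mu]_(x in D) (f w x)%:E)%E.
Proof.
under eq_fun do rewrite integral_g.
exact: measurable_fun_fubini_tonelli_F.
Qed.

Lemma tonelli_on :
  (\int[P]_w \int[mu]_(x in D) (f w x)%:E =
   \int[mu]_(x in D) \int[P]_w (f w x)%:E)%E.
Proof.
under eq_integral do rewrite integral_g.
rewrite fubini_tonelli// [RHS]integral_mkcond; apply: eq_integral => x _.
rewrite patchE /g/= indicE; case: ifPn => _.
  by under eq_integral do rewrite mul1r.
by apply: integral0_eq => w _; rewrite mul0r.
Qed.

End Tonelli.

Lemma integral_tail_cut (D : set R) (f : R -> R) (c : R) :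
  (\int[mu]_(x in D) (f x * (x <= c)%R%:R)%:E =
   \int[mu]_(x in D `&` `]-oo, c]) (f x)%:E)%E.
Proof.
rewrite integral_mkcondr; apply: eq_integral => x _.
rewrite patchE mem_setE in_itv/=.
by case: ifPn => _; rewrite ?mulr1 ?mulr0.
Qed.

(** If, under the measure of density [G], the variable [a] has an exponential
tail, then its Laplace transform restricted to [s <= a] follows without knowing
the law of [a]: it suffices to integrate against [G] the identity
[exp(-u s) = exp(-u a) + \int_s^a u exp(-u x) dx], valid for [s <= a].
The weight [G] makes it possible to treat one coordinate of a pair at a time. *)
Lemma laplace_of_exponential_tail G a m C : 0 < m -> 0 <= C ->
  measurable_fun setT G -> measurable_fun setT a -> (forall w, 0 <= G w) ->
  (forall s, 0 <= s ->
    (\int[P]_w (G w * (s <= a w)%R%:R)%:E = (C * expR (- (m * s)))%:E)%E) ->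
  forall u s, 0 <= u -> 0 <= s ->
    (\int[P]_w (G w * expR (- (u * a w)) * (s <= a w)%R%:R)%:E =
     (C * (m / (m + u)) * expR (- ((m + u) * s)))%:E)%E.
Proof.
move=> m0 C0 mG ma G0 tail u s u0 s0.
have mu0 : 0 < m + u by rewrite ltr_wpDr.
have indicator_m (x : R) : measurable_fun setT (fun w => (x <= a w)%R%:R : R).
  by apply: measurable_bool_natr; exact: measurable_fun_ler.
set X := (LHS).
have split w : ((expR (- (u * s)))%:E * (G w * (s <= a w)%R%:R)%:E =
    (G w * expR (- (u * a w)) * (s <= a w)%R%:R)%:E +
    \int[mu]_(x in `[s, +oo[)
      (u * expR (- (u * x)) * (G w * (x <= a w)%R%:R))%:E)%E.
  under [X in (_ = _ + X)%E]eq_integral do rewrite mulrCA EFinM.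
  rewrite ge0_integralZl//; last 3 first.
  - apply/measurable_EFinP; apply: measurable_funTS; apply: measurable_funM.
      apply: continuous_measurable_fun; exact: continuous_expR_scaled.
    by apply: measurable_bool_natr; exact: measurable_fun_ler.
  - by move=> x _; rewrite lee_fin !mulr_ge0 ?expR_ge0.
  - by rewrite lee_fin.
  rewrite integral_tail_cut.
  have -> : `[s, +oo[ `&` `]-oo, a w] = `[s, a w]%classic.
    by apply/seteqP; split=> x /=; rewrite !in_itv/= andbT => /andP.
  rewrite -!EFinM; have [sa|sa] := leP s (a w).
    by rewrite integral_expR_itv// !mulr1 -EFinM -EFinD; congr EFin; ring.
  rewrite set_itv_ge ?bnd_simp -?ltNge// integral_set0 mule0 adde0.
  by rewrite !mulr0.
have GE_m x : measurable_fun setT (fun w => (G w * (x <= a w)%R%:R)%:E).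
  by apply/measurable_EFinP; exact: measurable_funM.
have total : ((expR (- (u * s)) * (C * expR (- (m * s))))%:E =
    X + (u * C / (m + u) * expR (- ((m + u) * s)))%:E)%E.
  rewrite EFinM -tail// -ge0_integralZl//; last first.
    by move=> w _; rewrite lee_fin mulr_ge0.
  under eq_integral do rewrite split.
  have joint_m : measurable_fun setT (fun p : T * R =>
      u * expR (- (u * p.2)) * (G p.1 * (p.2 <= a p.1)%R%:R)).
    apply: measurable_funM.
      apply: measurable_funM => //; apply: measurable_expRN.
      by apply: measurable_funM => //; exact: measurable_snd.
    apply: measurable_funM; last exact: measurable_tail_indicator.
    exact: (measurableT_comp mG measurable_fst).
  have joint_ge0 w x :
      0 <= u * expR (- (u * x)) * (G w * (x <= a w)%R%:R).
    by rewrite !mulr_ge0 ?expR_ge0.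
  rewrite ge0_integralD//; last 4 first.
  - by move=> w _; rewrite lee_fin !mulr_ge0 ?expR_ge0.
  - apply/measurable_EFinP; apply: measurable_funM => //.
    apply: measurable_funM => //; apply: measurable_expRN.
    exact: measurable_funM.
  - by move=> w _; apply: integral_ge0 => x _; rewrite lee_fin.
  - exact: (measurable_integral_on _
      (fun w x => u * expR (- (u * x)) * (G w * (x <= a w)%R%:R))).
  congr (_ + _)%E.
  rewrite (tonelli_on _
    (fun w x => u * expR (- (u * x)) * (G w * (x <= a w)%R%:R)))//.
  transitivity (\int[mu]_(x in `[s, +oo[)
      ((u * C / (m + u))%:E * ((m + u) * expR (- ((m + u) * x)))%:E))%E.
    apply: eq_integral => x; rewrite inE/= in_itv/= andbT => sx.
    under eq_integral do rewrite EFinM.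
    rewrite ge0_integralZl//; last 2 first.
    - by move=> w _; rewrite lee_fin mulr_ge0.
    - by rewrite lee_fin mulr_ge0 ?expR_ge0.
    rewrite tail ?(le_trans s0)// -!EFinM; congr EFin.
    have -> : expR (- ((m + u) * x)) = expR (- (u * x)) * expR (- (m * x)).
      by rewrite -expRD; congr expR; ring.
    by field; rewrite gt_eqF.
  rewrite ge0_integralZl//; last 3 first.
  - apply/measurable_EFinP; apply: measurable_funTS.
    apply: continuous_measurable_fun.
    exact: continuous_expR_scaled.
  - by move=> x _; rewrite lee_fin mulr_ge0 ?expR_ge0// ltW.
  - by rewrite lee_fin divr_ge0 ?mulr_ge0// ltW.
  by rewrite integral_expR_ray.
rewrite -[X](@addeK _ (u * C / (m + u) * expR (- ((m + u) * s)))%:E)//.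
rewrite -total -EFinB; congr EFin.
have -> : expR (- ((m + u) * s)) = expR (- (u * s)) * expR (- (m * s)).
  by rewrite -expRD; congr expR; ring.
by field; rewrite gt_eqF.
Qed.

Section ExponentialPair.
Variables (m : R) (a b : T -> R).
Hypotheses (m_gt0 : 0 < m).
Hypotheses (ma : measurable_fun setT a) (mb : measurable_fun setT b).
Hypotheses (a_ge0 : forall w, 0 <= a w) (b_ge0 : forall w, 0 <= b w).
Hypothesis joint_tail : forall s t, 0 <= s -> 0 <= t ->
  P [set w | s <= a w /\ t <= b w] = (expR (- (m * (s + t))))%:E.

(** [laplace_of_exponential_tail] is used for [b] with weight [1{x <= a}], and
then for [a] with weight [exp(-u b)]. *)
Lemma joint_laplace u s : 0 <= u -> 0 <= s ->
  (\int[P]_w (expR (- (u * b w)) * expR (- (u * a w)) * (s <= a w)%R%:R)%:E =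
   ((m / (m + u)) ^+ 2 * expR (- ((m + u) * s)))%:E)%E.
Proof.
move=> u0 s0.
have mu0 : 0 < m + u by rewrite ltr_wpDr.
have ind_m x : measurable_fun setT (fun w => (x <= a w)%R%:R : R).
  by apply: measurable_bool_natr; exact: measurable_fun_ler.
have marginal x : 0 <= x ->
    (\int[P]_w (expR (- (u * b w)) * (x <= a w)%R%:R)%:E =
     (m / (m + u) * expR (- (m * x)))%:E)%E.
  move=> x0.
  transitivity (\int[P]_w ((x <= a w)%R%:R * expR (- (u * b w)) *
      (0 <= b w)%R%:R)%:E)%E.
    by apply: eq_integral => w _; rewrite b_ge0 mulr1 mulrC.
  rewrite (laplace_of_exponential_tail _ b m (expR (- (m * x))))//.
  - by rewrite mulr0 oppr0 expR0 mulr1 mulrC.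
  - move=> t t0; rewrite -expRD.
    have -> : - (m * x) - m * t = - (m * (x + t)) by ring.
    rewrite -joint_tail// -[in RHS](setIT [set w | _]) -integral_indic//.
      apply: eq_integral => w _; rewrite indicE -natrM mulnb.
      by congr (_%:R)%:E; congr nat_of_bool; apply/andP/idP; rewrite inE.
    have -> : [set w | x <= a w /\ t <= b w] =
        [set w | (x <= a w) && (t <= b w)] by apply/seteqP; split=> w /= /andP.
    have mab : measurable_fun setT (fun w => (x <= a w) && (t <= b w)).
      by apply: measurable_and; exact: measurable_fun_ler.
    by rewrite -[X in measurable X]setTI; exact: (mab measurableT [set true]).
rewrite (laplace_of_exponential_tail _ a m (m / (m + u)))//.
- by rewrite divr_ge0 ?ltW.
- by apply: measurable_expRN; exact: measurable_funM.
Qed.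

Lemma integral_min_indicator (c r : R) : 0 <= c -> 0 < r ->
  (\int[mu]_(s in `[0%R, r]) ((s <= c)%R%:R : R)%:E = (Num.min c r)%:E)%E.
Proof.
move=> c0 r0.
transitivity (\int[mu]_(s in `[0%R, r]) ((cst 1 s * (s <= c)%R%:R : R)%:E))%E.
  by apply: eq_integral => s _; rewrite mul1r.
rewrite (integral_tail_cut _ (cst 1)).
have -> : `[0, r] `&` `]-oo, c] = `[0, Num.min c r]%classic.
  apply/seteqP; split=> x /=; rewrite !in_itv/= le_min.
    by move=> [/andP[-> ->] ->].
  by move=> /and3P[-> -> ->].
rewrite (@integral_cst _ _ _ mu _ _ 1%E)// mul1e.
rewrite [LHS](lebesgue_measure_itv `[0, Num.min c r])/= lte_fin.
case: ifPn => [_|]; first by rewrite sube0.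
rewrite -leNgt => min_le0; congr EFin; apply/le_anti.
by rewrite min_le0 le_min c0 ltW.
Qed.

Lemma joint_laplace_min (u r : R) : 0 <= u -> 0 < r ->
  (\int[P]_w (expR (- (u * b w)) * expR (- (u * a w)) * Num.min (a w) r)%:E =
   (m ^+ 2 / (m + u) ^+ 3 * (1 - expR (- ((m + u) * r))))%:E)%E.
Proof.
move=> u0 r0.
have mu0 : 0 < m + u by rewrite ltr_wpDr.
transitivity (\int[P]_w \int[mu]_(s in `[0%R, r])
    (expR (- (u * b w)) * expR (- (u * a w)) * (s <= a w)%R%:R)%:E)%E.
  apply: eq_integral => w _; rewrite EFinM -integral_min_indicator//.
  rewrite -ge0_integralZl//.
  apply/measurable_EFinP; apply: measurable_funTS.
  by apply: measurable_bool_natr; exact: measurable_fun_ler.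
rewrite (tonelli_on _ (fun w s =>
  expR (- (u * b w)) * expR (- (u * a w)) * (s <= a w)%R%:R))//; last first.
  apply: measurable_funM; last exact: measurable_tail_indicator.
  apply: measurable_funM; apply: measurable_expRN; apply: measurable_funM => //.
    exact: (measurableT_comp mb measurable_fst).
  exact: (measurableT_comp ma measurable_fst).
transitivity (\int[mu]_(s in `[0%R, r])
    ((m ^+ 2 / (m + u) ^+ 3)%:E * ((m + u) * expR (- ((m + u) * s)))%:E))%E.
  apply: eq_integral => s; rewrite inE/= in_itv/= => /andP[s0 _].
  rewrite joint_laplace// -EFinM; congr EFin; field.
  by rewrite gt_eqF.
rewrite ge0_integralZl//; last 3 first.
- apply/measurable_EFinP; apply: measurable_funTS.
  apply: continuous_measurable_fun; exact: continuous_expR_scaled.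
- by move=> s _; rewrite lee_fin mulr_ge0 ?expR_ge0// ltW.
- by rewrite lee_fin divr_ge0 ?exprn_ge0// ltW.
rewrite integral_expR_itv ?ltW// mulr0 oppr0 expR0 -EFinM.
by [].
Qed.

(** This is [1 / D = \int_0^oo exp(- u D) du] with [u = t / r - m]: the new
variable [t = (m + u) r] makes the last integral of the computation start at
[m r] and have an integrand free of parameters. *)
Lemma reciprocal_integral (r D : R) : 0 < r -> 0 < D ->
  (\int[mu]_(t in `[(m * r)%R, +oo[) (r^-1 * expR (- ((t / r - m) * D)))%:E =
   (D^-1)%:E)%E.
Proof.
move=> r0 D0; have Dr0 : 0 < D / r by rewrite divr_gt0.
transitivity (\int[mu]_(t in `[(m * r)%R, +oo[)
    ((expR (m * D) / D)%:E * (D / r * expR (- (D / r * t)))%:E))%E.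
  apply: eq_integral => t _; rewrite -EFinM; congr EFin.
  have -> : - ((t / r - m) * D) = m * D + - (D / r * t) by ring.
  by rewrite expRD; field; rewrite !gt_eqF.
rewrite ge0_integralZl//; last 3 first.
- apply/measurable_EFinP; apply: measurable_funTS.
  apply: continuous_measurable_fun; exact: continuous_expR_scaled.
- by move=> s _; rewrite lee_fin mulr_ge0 ?expR_ge0// ltW.
- by rewrite lee_fin divr_ge0 ?expR_ge0// ltW.
rewrite integral_expR_ray// -EFinM mulrAC -expRD.
have -> : m * D - D / r * (m * r) = 0 by field; rewrite gt_eqF.
by rewrite expR0 mul1r.
Qed.

Lemma expectation_min_ratio r : 0 < r ->
  (\int[P]_w (Num.min (a w) r / (a w + b w))%:E =
   ((1 - expR (- (m * r)) + m * r * expR (- (m * r)) -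
     (m * r) ^+ 2 * E1 (m * r)) / 2)%:E)%E.
Proof.
move=> r0; have mr0 : 0 < m * r by rewrite mulr_gt0.
have min_m : measurable_fun setT (fun w => Num.min (a w) r).
  exact: measurable_minr.
have min_ge0 w : 0 <= Num.min (a w) r by rewrite le_min a_ge0 ltW.
pose k w t := r^-1 * (expR (- ((t / r - m) * b w)) *
  expR (- ((t / r - m) * a w)) * Num.min (a w) r).
transitivity (\int[P]_w \int[mu]_(t in `[(m * r)%R, +oo[) (k w t)%:E)%E.
  apply: eq_integral => w _.
  transitivity (\int[mu]_(t in `[(m * r)%R, +oo[) ((Num.min (a w) r)%:E *
      (r^-1 * expR (- ((t / r - m) * (a w + b w))))%:E))%E; last first.
    apply: eq_integral => t _; rewrite -EFinM /k -expRD; congr EFin.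
    have -> : - ((t / r - m) * b w) - (t / r - m) * a w =
      - ((t / r - m) * (a w + b w)) by ring.
    by ring.
  (* When [a w + b w = 0], the integral of the exponential diverges but is
     multiplied by [min (a w) r = 0], in accordance with [0 / 0 = 0]. *)
  have := addr_ge0 (a_ge0 w) (b_ge0 w).
  rewrite le_eqVlt => /predU1P[D0|D0].
    have a0 : a w = 0.
      by move/esym/eqP: D0; rewrite paddr_eq0// => /andP[/eqP].
    rewrite a0 min_l ?ltW// mul0r; apply/esym/integral0_eq => t _.
    by rewrite mul0e.
  rewrite ge0_integralZl//.
  - by rewrite reciprocal_integral.
  - apply/measurable_EFinP; apply: measurable_funTS.
    apply: measurable_funM => //.
    apply: measurable_expRN; apply: measurable_funM => //.
    by apply: measurable_funB => //; exact: measurable_funM.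
  - by move=> t _; rewrite lee_fin mulr_ge0 ?expR_ge0// invr_ge0 ltW.
  - by rewrite lee_fin.
rewrite (tonelli_on _ k)//; last 2 first.
- apply: measurable_funM => //; apply: measurable_funM; last first.
    exact: (measurableT_comp min_m measurable_fst).
  have rate_m : measurable_fun setT (fun t : R => t / r - m).
    by apply: measurable_funB => //; exact: measurable_funM.
  have {}rate_m := measurableT_comp rate_m (@measurable_snd _ _ T _).
  apply: measurable_funM; apply: measurable_expRN; apply: measurable_funM => //.
    exact: (measurableT_comp mb measurable_fst).
  exact: (measurableT_comp ma measurable_fst).
- by move=> w t _; rewrite /k !mulr_ge0 ?expR_ge0// invr_ge0 ltW.
transitivity (\int[mu]_(t in `[(m * r)%R, +oo[)
    (((m * r) ^+ 2 / 2)%:E * (2 * t^-1 ^+ 3 * (1 - expR (- t)))%:E))%E.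
  apply: eq_integral => t; rewrite inE/= in_itv/= andbT => mrt.
  have t0 : 0 < t by exact: lt_le_trans mrt.
  have u0 : 0 <= t / r - m by rewrite subr_ge0 ler_pdivlMr.
  under eq_integral do rewrite EFinM.
  rewrite ge0_integralZl//; last 3 first.
  - apply/measurable_EFinP; apply: measurable_funM => //.
    by apply: measurable_funM; apply: measurable_expRN; exact: measurable_funM.
  - by move=> w _; rewrite lee_fin !mulr_ge0 ?expR_ge0.
  - by rewrite lee_fin invr_ge0 ltW.
  rewrite joint_laplace_min// -!EFinM addrC subrK divfK ?gt_eqF//; congr EFin.
  by field; rewrite !gt_eqF.
rewrite ge0_integralZl//; last 3 first.
- by apply: measurable_tail_integrand.
- move=> t; rewrite /= in_itv/= andbT => mrt; rewrite lee_fin.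
  by apply: tail_integrand_ge0; exact: lt_le_trans mrt.
- by rewrite lee_fin divr_ge0 ?exprn_ge0// ltW.
rewrite integral_tail_E1// -EFinM; congr EFin.
by field; rewrite !gt_eqF.
Qed.

End ExponentialPair.
End Probability.

(** * The typical cell of a point configuration on the line *)

Section CellGeometry.
Context {R : realType}.
Local Notation mu := (@lebesgue_measure R).
Implicit Types (phi : set R) (r s x y : R).

(** The default value of [inf] makes this [0] when [phi] has no positive point. *)
Definition half_gap phi : R := inf [set x | 0 < x /\ phi (2 * x)].

Definition mirror phi : set R := [set x | phi (- x)].

Lemma half_gap_ge0 phi : 0 <= half_gap phi.
Proof.
rewrite /half_gap; set A := (X in inf X).
have [->|/set0P A0] := eqVneq A set0; first by rewrite inf0.
by apply: lb_le_inf => // x [/ltW].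
Qed.

Lemma half_gap0 phi : phi `&` `]0, +oo[ = set0 -> half_gap phi = 0.
Proof.
move=> phi0; rewrite /half_gap (_ : [set x | _] = set0) ?inf0//.
apply/seteqP; split=> x //= [x0 phix].
suff : (phi `&` `]0, +oo[) (2 * x) by rewrite phi0.
by split => //=; rewrite in_itv/= andbT mulr_gt0.
Qed.

(** The interval is open at [2 * s], hence the equivalence holds whether or not
the infimum is attained. *)
Lemma le_half_gapP phi s : phi `&` `]0, +oo[ !=set0 ->
  s <= half_gap phi <-> phi `&` `]0, 2 * s[ = set0.
Proof.
move=> [p [phip]]; rewrite /= in_itv/= andbT => p0.
split=> [s_le|void].
  apply/seteqP; split=> x //= [phix]; rewrite in_itv/= => /andP[x0 xs].
  suff : half_gap phi <= x / 2 by lra.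
  apply: ge_inf; first by exists 0 => y [/ltW].
  by split; [lra|rewrite mulrC divfK].
apply: lb_le_inf.
  by exists (p / 2); split; [lra|rewrite mulrC divfK].
move=> x [x0 phix]; rewrite leNgt; apply/negP => xs.
suff : (phi `&` `]0, 2 * s[) (2 * x) by rewrite void.
by split => //=; rewrite in_itv/=; apply/andP; split; lra.
Qed.

Lemma mirror_void phi s : mirror phi `&` `]0, 2 * s[ = set0 <->
  phi `&` `](- (2 * s)), 0[ = set0.
Proof.
split=> void; apply/seteqP; split=> x //= [phix]; rewrite in_itv/= => xs.
  suff : (mirror phi `&` `]0, 2 * s[) (- x) by rewrite void.
  by split; rewrite /mirror/= ?opprK// in_itv/= oppr_gt0 ltrNl andbC.
suff : (phi `&` `](- (2 * s)), 0[) (- x) by rewrite void.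
by split => //=; rewrite in_itv/= ltrN2 oppr_lt0 andbC.
Qed.

Lemma mirror_ray phi : mirror phi `&` `]0, +oo[ = set0 <->
  phi `&` `]-oo, 0[ = set0.
Proof.
split=> void; apply/seteqP; split=> x //= [phix]; rewrite in_itv/= ?andbT => x0.
  suff : (mirror phi `&` `]0, +oo[) (- x) by rewrite void.
  by split; rewrite /mirror/= ?opprK// in_itv/= oppr_gt0 x0.
suff : (phi `&` `]-oo, 0[) (- x) by rewrite void.
by split => //=; rewrite in_itv/= oppr_lt0.
Qed.

(** Squaring turns the inequality into [0 <= x (x - 2 y)]: the point [x] beats
the origin for [y] exactly when it lies strictly between [0] and [2 y]. *)
Lemma nearer_to_origin x y : (`|y| <= `|x - y|) =
  ~~ (0 < x < 2 * y) && ~~ (2 * y < x < 0).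
Proof.
apply/idP/andP => [|[/negP n1 /negP n2]].
  by case: (ger0P y) => y0; case: (ger0P (x - y)) => xy0 yxy;
    split; apply/negP => /andP[? ?]; lra.
rewrite leNgt; apply/negP; case: (ger0P y) => y0.
  case: (ger0P (x - y)) => xy0 yxy; apply: n1; apply/andP; split; lra.
case: (ger0P (x - y)) => xy0 yxy; apply: n2; apply/andP; split; lra.
Qed.

Lemma typical_cell_itv phi :
  phi `&` `]0, +oo[ !=set0 -> phi `&` `]-oo, 0[ !=set0 ->
  typical_cell phi = `[(- half_gap (mirror phi)), half_gap phi]%classic.
Proof.
move=> right left.
have mright : mirror phi `&` `]0, +oo[ !=set0.
  by apply/set0P/eqP => /mirror_ray left0; move/set0P/eqP: left; exact.
apply/seteqP; split=> y /=; rewrite in_itv/=.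
  move=> cell_y; apply/andP; split.
    rewrite lerNl; apply/(le_half_gapP _ _ mright)/mirror_void.
    apply/seteqP; split=> x //= [/cell_y].
    by rewrite in_itv/= nearer_to_origin mulrN opprK => /andP[_ /negP].
  apply/le_half_gapP => //.
  apply/seteqP; split=> x //= [/cell_y].
  by rewrite in_itv/= nearer_to_origin => /andP[/negP].
rewrite lerNl => /andP[/(le_half_gapP _ _ mright)/mirror_void voidl].
move=> /(le_half_gapP _ _ right) voidr x phix; rewrite nearer_to_origin.
apply/andP; split; apply/negP => xy.
  by suff : (phi `&` `]0, 2 * y[) x by [rewrite voidr]; split.
suff : (phi `&` `](- (2 * - y)), 0[) x by rewrite voidl.
by split=> //=; rewrite in_itv/= mulrN opprK.
Qed.

Lemma uniform_on_itv (a b r : R) : 0 <= a -> 0 <= b -> 0 < r ->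
  uniform_on `[(- b), a] `[(- r), r] =
  Num.min a r / (a + b) + Num.min b r / (b + a).
Proof.
move=> a0 b0 r0; rewrite /uniform_on.
have itv_length (x y : R) : 0 <= x -> 0 <= y ->
    fine (mu `[(- y), x]) = x + y.
  move=> x0 y0; rewrite [mu _](lebesgue_measure_itv `[(- y), x])/= lte_fin.
  by case: ifPn => [_|]; rewrite ?opprK//= -leNgt; lra.
have -> : `[(- b), a] `&` `[(- r), r] = `[(- Num.min b r), Num.min a r]%classic.
  apply/seteqP; split=> x /=; rewrite !in_itv/= !(lerNl _ x) !le_min.
    by move=> [/andP[-> ->] /andP[-> ->]].
  by move=> /andP[/andP[-> ->] /andP[-> ->]].
by rewrite !itv_length ?le_min ?a0 ?b0 ?ltW// [b + a]addrC mulrDl.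
Qed.

End CellGeometry.

(** * Void probabilities of the Poisson process *)

Section Poisson.
Context {R : realType} {d : measure_display} {T : measurableType d}.
Variables (P : probability T R) (lambda : R) (Phi : T -> set R).
Hypothesis lambda_gt0 : 0 < lambda.
Hypothesis hPhi : homogeneous_poisson_process P lambda Phi.
Local Notation mu := (@lebesgue_measure R).

Definition void (B : set R) : set T := [set w | Phi w `&` B = set0].

Lemma voidE B : void B = point_count Phi B @^-1` [set 0%:E].
Proof.
apply/seteqP; split=> w; rewrite /void/point_count/=.
  by move=> ->; exact: measure0.
rewrite /counting; case: ifPn => // /asboolP fin [] /eqP.
by rewrite pnatr_eq0 finmap.cardfs_eq0 => /eqP; exact: fset_set_set0.
Qed.

Lemma void_in_process_algebra B : measurable B ->
  process_sigma_algebra Phi (void B).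
Proof.
move=> mB; apply: sub_sigma_algebra; exists B; split => //.
by exists [set 0%:E]; split; [exact: emeasurable_set1|exact: voidE].
Qed.

Lemma measurable_void B : measurable B -> measurable (void B).
Proof.
move=> mB; rewrite voidE -[X in measurable X]setTI.
have [[_ mcount] _ _] := hPhi.
by apply: mcount => //; exact: emeasurable_set1.
Qed.

Lemma void_probability B : measurable B -> (mu B < +oo)%E ->
  P (void B) = (expR (- (lambda * fine (mu B))))%:E.
Proof.
move=> mB Bfin; have [_ count _] := hPhi.
have := count B mB Bfin 0%N; rewrite /= expr0 fact0 divr1 mul1r => <-.
by rewrite voidE.
Qed.

Lemma void_sub B C : B `<=` C -> void C `<=` void B.
Proof. by move=> BC w /= C0; apply/subsetI_eq0: C0. Qed.

Lemma lebesgue_measure_oo (x y : R) : x <= y -> mu `]x, y[ = (y - x)%:E.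
Proof.
move=> xy; rewrite [LHS](lebesgue_measure_itv `]x, y[)/= lte_fin.
case: ifPn => //; rewrite -leNgt => yx; congr EFin; lra.
Qed.

Lemma expR_small_eq0 (p : \bar R) : (0 <= p)%E ->
  (forall t, 0 <= t -> (p <= (expR (- t))%:E)%E) -> p = 0%E.
Proof.
case: p => [p| |] //; last by move=> _ /(_ 0 (lexx _)); rewrite leye_eq.
rewrite lee_fin le_eqVlt => /predU1P[<-//|p0] small.
have t0 : 0 <= Num.max 0 (1 - ln p) by rewrite le_max lexx.
have := small _ t0; rewrite lee_fin leNgt => /negP[].
rewrite -[ltRHS](lnK p0) ltr_expR ltrNl lt_max; apply/orP; right; lra.
Qed.

(** A half-line contains intervals of any length, whose void probabilities are
arbitrarily small. *)
Lemma void_right0 : P (void `]0, +oo[) = 0%E.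
Proof.
apply: expR_small_eq0 => [|t t0]; first exact: measure_ge0.
have tl : 0 <= t / lambda by rewrite divr_ge0 // ltW.
have -> : (expR (- t))%:E = P (void `]0, t / lambda[).
  rewrite void_probability// lebesgue_measure_oo ?ltry//=.
  by rewrite subr0 mulrC divfK ?gt_eqF.
apply: le_measure; rewrite ?inE; try exact: measurable_void.
by apply: void_sub; exact: subset_itvl.
Qed.

Lemma void_left0 : P (void `]-oo, 0[) = 0%E.
Proof.
apply: expR_small_eq0 => [|t t0]; first exact: measure_ge0.
have tl : 0 <= t / lambda by rewrite divr_ge0 // ltW.
have -> : (expR (- t))%:E = P (void `](- (t / lambda)), 0[).
  rewrite void_probability// lebesgue_measure_oo ?oppr_le0 ?ltry//=.
  by rewrite sub0r opprK mulrC divfK ?gt_eqF.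
apply: le_measure; rewrite ?inE; try exact: measurable_void.
by apply: void_sub; exact: subset_itvr.
Qed.

(** The null event on which the cell may be unbounded. *)
Definition one_sided : set T := void `]0, +oo[ `|` void `]-oo, 0[.

Lemma measurable_one_sided : measurable one_sided.
Proof. by apply: measurableU; exact: measurable_void. Qed.

Lemma one_sided0 : P one_sided = 0%E.
Proof.
apply: null_set_setU; do ?exact: measurable_void.
  exact: void_right0.
exact: void_left0.
Qed.

(** The conditional law of [Y] is prescribed on the events of this
sigma-algebra only.  On the present one, which is almost sure, every cell is a
segment, so that the conditional probability is a function of its end points on
the whole domain of integration. *)
Lemma two_sided_in_process_algebra : process_sigma_algebra Phi (~` one_sided).
Proof.
apply: (@measurableC _ (g_sigma_algebraType _)).
by apply: (@measurableU _ (g_sigma_algebraType _));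
  exact: void_in_process_algebra.
Qed.

Lemma two_sidedP w : (~` one_sided) w ->
  Phi w `&` `]0, +oo[ !=set0 /\ Phi w `&` `]-oo, 0[ !=set0.
Proof.
by move=> /not_orP[nr nl]; split; apply/set0P/eqP.
Qed.

Definition right_reach w := half_gap (Phi w).
Definition left_reach w := half_gap (mirror (Phi w)).

(** [gap s] is the region that has to be void for the reach to be at least [s],
and [ray] the half-line whose voidness sends the reach to its default value. *)
Lemma measurable_reach (a : T -> R) (ray : set R) (gap : R -> set R) :
  (forall w, 0 <= a w) -> measurable ray -> (forall s, measurable (gap s)) ->
  (forall w, void ray w -> a w = 0) ->
  (forall s w, ~ void ray w -> s <= a w <-> void (gap s) w) ->
  measurable_fun setT a.
Proof.
move=> a0 mray mgap a_ray a_gap.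
apply: (measurability _ (RGenCInfty.measurableE R)) => _ [_ [s ->] <-].
rewrite setTI; have [s0|s0] := leP s 0.
  rewrite (_ : _ @^-1` _ = setT)//; apply/seteqP; split=> w //= _.
  by rewrite in_itv/= andbT (le_trans s0).
rewrite (_ : _ @^-1` _ = void (gap s) `\` void ray).
  by apply: measurableD; exact: measurable_void.
apply/seteqP; split=> w /=; rewrite in_itv/= andbT.
  move=> sa; have nray : ~ void ray w by move=> /a_ray aw0; move: sa; lra.
  by split => //; apply/(a_gap s w).
by move=> [gapw nray]; apply/(a_gap s w).
Qed.

Lemma le_right_reach s w : ~ void `]0, +oo[ w ->
  s <= right_reach w <-> void `]0, 2 * s[ w.
Proof. by move=> /eqP/set0P; exact: le_half_gapP. Qed.

Lemma le_left_reach s w : ~ void `]-oo, 0[ w ->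
  s <= left_reach w <-> void `](- (2 * s)), 0[ w.
Proof.
move=> nl; rewrite /left_reach le_half_gapP; first exact: mirror_void.
by apply/set0P/eqP => /mirror_ray.
Qed.

Lemma measurable_right_reach : measurable_fun setT right_reach.
Proof.
apply: (measurable_reach _ `]0, +oo[ (fun s => `]0, 2 * s[%classic)) => //.
- by move=> w; exact: half_gap_ge0.
- by move=> w; exact: half_gap0.
- by move=> s w; exact: le_right_reach.
Qed.

Lemma measurable_left_reach : measurable_fun setT left_reach.
Proof.
apply: (measurable_reach _ `]-oo, 0[
  (fun s => `](- (2 * s)), 0[%classic)) => //.
- by move=> w; exact: half_gap_ge0.
- by move=> w /mirror_ray; exact: half_gap0.
- by move=> s w; exact: le_left_reach.
Qed.

(** The two events are voidness of [(0, 2 s)] and of [(-2 t, 0)], so that their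
intersection is a single void event; the independence of the counts is built
into its probability, which is multiplicative in disjoint regions. *)
Lemma reach_joint_tail (s t : R) : 0 <= s -> 0 <= t ->
  P [set w | s <= right_reach w /\ t <= left_reach w] =
  (expR (- (2 * lambda * (s + t))))%:E.
Proof.
move=> s0 t0.
pose B : set R := `](- (2 * t)), 0[ `|` `]0, 2 * s[.
have mB : measurable B by exact: measurableU.
have muB : mu B = (2 * (s + t))%:E.
  transitivity (mu `](- (2 * t))%R, 0%R[ + mu `]0%R, (2 * s)%R[)%E; last first.
    rewrite !lebesgue_measure_oo ?mulr_ge0 ?oppr_le0 ?mulr_ge0//.
    by rewrite -EFinD; congr EFin; ring.
  apply: measureU => //; apply/seteqP; split=> x //=; rewrite !in_itv/=.
  move=> [/andP[_ x0] /andP[x0' _]].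
  by move: x0'; rewrite ltNge ltW.
transitivity (P (void B)); last first.
  by rewrite void_probability ?muB ?ltry//=; congr (expR _)%:E; ring.
apply: (eq_measure_off_null P _ _ one_sided).
- rewrite (_ : [set w | _] = (right_reach @^-1` `[s, +oo[) `&`
      (left_reach @^-1` `[t, +oo[)); last first.
    by apply/seteqP; split=> w /=; rewrite !in_itv/= !andbT.
  apply: measurableI; rewrite -[X in measurable X]setTI.
    exact: (measurable_right_reach measurableT).
  exact: (measurable_left_reach measurableT).
- exact: measurable_void.
- exact: measurable_one_sided.
- exact: one_sided0.
apply/seteqP; split=> w [wB two]; split=> //; move: (two) => /not_orP[nr nl].
  case: wB => /(le_right_reach _ _ nr) r0 /(le_left_reach _ _ nl) l0.
  by rewrite /void/= setIUr r0 l0 setU0.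
split.
  by apply/(le_right_reach _ _ nr); apply: void_sub wB; exact: subsetUr.
by apply/(le_left_reach _ _ nl); apply: void_sub wB; exact: subsetUl.
Qed.

End Poisson.

(** * The distribution of the distance to the nucleus *)

Theorem theorem1 (R : realType) (d : measure_display) (T : measurableType d)
    (P : probability T R) (lambda : R) (lambda_gt0 : 0 < lambda)
    (Phi : T -> set R) (hPhi : homogeneous_poisson_process P lambda Phi)
    (Y : {RV P >-> R}) (hY : uniform_in_typical_cell P Phi Y)
    (r : R) (r_gt0 : 0 < r) :
  cdf (distance_to_nucleus Y) r =
  (1 - expR (- (2 * lambda * r)) +
   2 * lambda * r * expR (- (2 * lambda * r)) -
   4 * lambda ^+ 2 * r ^+ 2 * E1 (2 * lambda * r))%:E.
Proof.
set N := one_sided Phi.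
have mN : measurable N := measurable_one_sided P lambda Phi hPhi.
have N0 : P N = 0%E := one_sided0 P lambda Phi lambda_gt0 hPhi.
set a := right_reach Phi; set b := left_reach Phi.
have ma : measurable_fun setT a := measurable_right_reach P lambda Phi hPhi.
have mb : measurable_fun setT b := measurable_left_reach P lambda Phi hPhi.
have a0 w : 0 <= a w by exact: half_gap_ge0.
have b0 w : 0 <= b w by exact: half_gap_ge0.
have tail := reach_joint_tail P lambda Phi lambda_gt0 hPhi.
have rate0 : 0 < 2 * lambda by rewrite mulr_gt0.
have ball_m : measurable (`[(- r), r]%classic : set R) by exact: measurable_itv.
pose ratio (u v : T -> R) w := Num.min (u w) r / (u w + v w).
have ratio_ge0 (u v : T -> R) w : 0 <= u w -> 0 <= v w -> 0 <= ratio u v w.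
  by move=> u0 v0; rewrite divr_ge0 ?addr_ge0// le_min u0 ltW.
have ratio_m (u v : T -> R) : (forall w, 0 <= u w) -> (forall w, 0 <= v w) ->
    measurable_fun setT u -> measurable_fun setT v ->
    measurable_fun setT (fun w => (ratio u v w)%:E).
  by move=> u0 v0 um vm; apply/measurable_EFinP; exact: measurable_min_ratio.
transitivity (P (~` N `&` Y @^-1` `[(- r), r])).
  have normY : Y @^-1` `[(- r), r] = (Num.norm \o Y)%FUN @^-1` `]-oo, r].
    by apply/seteqP; split=> w; rewrite /= !in_itv/= ler_norml.
  rewrite /cdf/distribution/pushforward/=.
  apply: (eq_measure_off_null P _ _ N) => //.
  - by rewrite -normY; exact: measurable_funPTI.
  - by apply: measurableI; [exact: measurableC|exact: measurable_funPTI].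
  - by rewrite normY setIC -setDE setDDl setUid.
rewrite hY//; last exact: two_sided_in_process_algebra.
transitivity (\int[P]_(w in ~` N) (ratio a b w + ratio b a w)%:E)%E.
  apply: eq_integral => w; rewrite inE => /two_sidedP[right left].
  rewrite typical_cell_itv//; congr EFin.
  exact: uniform_on_itv (a0 w) (b0 w) r_gt0.
transitivity (\int[P]_w (ratio a b w + ratio b a w)%:E)%E.
  rewrite [RHS](ge0_negligible_integral mN)// ?setTD//.
  - under eq_fun do rewrite EFinD.
    by apply: emeasurable_funD; exact: ratio_m.
  - by move=> w _; rewrite lee_fin addr_ge0 ?ratio_ge0.
under eq_integral do rewrite EFinD.
rewrite ge0_integralD//; last 4 first.
- by move=> w _; rewrite lee_fin ratio_ge0.
- exact: ratio_m.
- by move=> w _; rewrite lee_fin ratio_ge0.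
- exact: ratio_m.
rewrite (expectation_min_ratio P (2 * lambda) a b)//.
rewrite (expectation_min_ratio P (2 * lambda) b a)//; last first.
  move=> s t s0 t0; rewrite addrC -tail//; congr (P _).
  by apply/seteqP; split=> w /= [].
by rewrite -EFinD; congr EFin; field.
Qed.
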